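(* An optimal balking threshold for the problem $P^*=\max_{\underline n\le n_0\le\overline n}H(n_0)$ is $$n_P=\max(\underline n,\min(\tilde n_P,\overline n)),$$ where $\tilde n_P=\min\{n_0:A(n_0)<0\}$ and $$A(n_0)=G_{n_0}(\tilde d^P_{n_0})\sum_{n=0}^{n_0}\rho^n-\rho\sum_{n=0}^{n_0-1}\rho^nG_n(\tilde d^P_n).$$
   Context: Parameters: $\lambda,\mu>0$ (arrival and service rates), $\rho=\lambda/\mu$; service value $R$, entrance fee $p$, waiting cost rate $c>0$, compensation rate $l$, risk-aversion coefficient $r>0$, with $0\le p\le R$ and $0\le l\le c$. For each integer $n\ge 0$, $X_n\sim Gamma(n+1,\mu)$ has density $\mu^{n+1}x^ne^{-\mu x}/n!$ on $(0,\infty)$. A lead-time quote is $d\in[0,\infty]$; $d=\infty$ means no compensation, with $(x-\infty)^+=0$. Expected utility of a joining customer who finds $n$ customers and is quoted $d$: $$B_n(d)=E\left[\frac{1-e^{-r(R-p-cX_n+l(X_n-d)^+)}}{r}\right]\in[-\infty,\infty).$$ The customer joins iff $B_n(d)\ge 0$. Let $L_n(d)=E(X_n-d)^+$, and let $G_n(d)=p-lL_n(d)$ if $B_n(d)\ge0$, $G_n(d)=0$ if $B_n(d)<0$. Put $\underline n=\inf\{n\ge0:\lim_{d\to\infty}B_n(d)<0\}$, $\overline n=\inf\{n\ge0:B_n(0)<0\}$ (with $\inf\varnothing=\infty$), $q(n;n_0)=\rho^n/\sum_{k=0}^{n_0}\rho^k$ for $0\le n\le n_0$, and $\tilde d^P_n=\sup\{d\ge0:B_n(d)\ge0\}$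 with $\sup\varnothing=-1$. For a (finite) integer $n_0$ with $\underline n\le n_0\le\overline n$, $H(n_0)$ is the supremum of $\lambda\sum_{n=0}^{n_0-1}q(n;n_0)G_n(d_n)$ over all $(d_0,\ldots,d_{n_0})\in[0,\infty]^{n_0+1}$ with $B_n(d_n)\ge0$ for $n=0,\ldots,n_0-1$ and $B_{n_0}(d_{n_0})<0$. The maximum of $H$ is over finite integers in this range. In the definition of $\tilde n_P$ the minimum is over integers $0\le n_0<\overline n$, with $\min\varnothing=\infty$. *)

(* Defs.v *)
From HB Require Import structures.
From mathcomp Require Import all_boot all_order all_algebra.
From mathcomp Require Import all_classical all_reals all_analysis.

Set Implicit Arguments.
Unset Strict Implicit.
Unset Printing Implicit Defensive.

Import Order.TTheory GRing.Theory Num.Theory.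
Import numFieldNormedType.Exports.

Local Open Scope classical_set_scope.
Local Open Scope ring_scope.

Definition gamma_pdf (K : realType) (n : nat) (mu x : K) : K :=
  if 0 < x then mu ^+ n.+1 * x ^+ n * expR (- (mu * x)) / n`!%:R else 0.

(* X ~ Gamma(n + 1, mu) *)
Definition gamma_distributed (K : realType) (disp : measure_display)
    (T : measurableType disp) (P : probability T K) (X : {RV P >-> K})
    (n : nat) (mu : K) : Prop :=
  forall S : set K, measurable S ->
    distribution P X S =
      (\int[lebesgue_measure]_(x in S) (gamma_pdf n mu x)%:E)%E.

(* Elements of N u {oo} are represented in \bar K; ereal_inf set0 = +oo, and
   the infimum of a nonempty set of natural numbers is its minimum. *)
Definition nat_inf (K : realType) (S : set nat) : \bar K :=
  ereal_inf [set n%:R%:E | n in S].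

(* (x - d)^+ for d in ]-oo, +oo]; in particular (x - oo)^+ = 0. *)
Definition excess (K : realType) (x : K) (d : \bar K) : K :=
  fine (maxe (x%:E - d) 0)%E.

Section queue.
Context (K : realType) (disp : measure_display) (T : measurableType disp).
Context (P : probability T K) (X : nat -> {RV P >-> K}).
(* lambda, ..., r: arrival rate, service rate, service value, entrance fee, waiting cost rate,
   compensation rate, risk aversion *)
Context (lambda mu R p c l r : K).

Let rho : K := lambda / mu.

(* B_n(d); the integrand is bounded above by 1 / r, so that the expectation
   is well defined, with value -oo when exp has infinite expectation. *)
Definition utility (n : nat) (d : \bar K) : \bar K :=
  ('E_P[fun w =>
         ((1 - expR (- (r * (R - p - c * X n w + l * excess (X n w) d)))) / r)%R
       ])%E.

(* L_n(d) *)
Definition lateness (n : nat) (d : \bar K) : \bar K :=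
  ('E_P[fun w => excess (X n w) d])%E.

(* G_n(d); [fine] is harmless: L_n(d) is finite since X_n is integrable. *)
Definition gain (n : nat) (d : \bar K) : K :=
  if (0 <= utility n d)%E then p - l * fine (lateness n d) else 0.

Definition n_low : \bar K :=
  nat_inf K [set n | (lim (utility n d%:E @[d --> +oo%R]) < 0)%E].

Definition n_high : \bar K := nat_inf K [set n | (utility n 0 < 0)%E].

Definition q (n n0 : nat) : K := rho ^+ n / \sum_(k < n0.+1) rho ^+ k.

(* \tilde d^P_n, with the convention sup set0 = -1 *)
Definition d_tilde (n : nat) : \bar K :=
  let S := [set d : \bar K | (0 <= d)%E /\ (0 <= utility n d)%E] in
  if `[< S = set0 >] then (-1)%:E else ereal_sup S.

(* the quotes d_0, ..., d_n0 in [0, oo] inducing balking exactly at n0 *)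
Definition admissible (n0 : nat) (d : 'I_n0.+1 -> \bar K) : Prop :=
  [/\ forall i, (0 <= d i)%E,
      forall i : 'I_n0.+1, (i < n0)%N -> (0 <= utility i (d i))%E
    & (utility n0 (d ord_max) < 0)%E].

Definition H (n0 : nat) : \bar K :=
  ereal_sup [set (lambda * \sum_(i < n0.+1 | (i < n0)%N)
                             q i n0 * gain i (d i))%:E
            | d in @admissible n0].

Definition in_range (n0 : nat) : Prop :=
  (n_low <= n0%:R%:E)%E /\ (n0%:R%:E <= n_high)%E.

Definition optimal_threshold (n0 : nat) : Prop :=
  in_range n0 /\ forall m : nat, in_range m -> (H m <= H n0)%E.

Definition A (n0 : nat) : K :=
  gain n0 (d_tilde n0) * (\sum_(n < n0.+1) rho ^+ n)
  - rho * \sum_(n < n0) rho ^+ n * gain n (d_tilde n).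

Definition n_tilde : \bar K :=
  nat_inf K [set n0 | (n0%:R%:E < n_high)%E /\ A n0 < 0].

Definition n_P : \bar K := maxe n_low (mine n_tilde n_high).

End queue.

(* Main.v *)
Require Import Defs.
From HB Require Import structures.
From mathcomp Require Import all_boot all_order all_algebra.
From mathcomp Require Import all_classical all_reals all_analysis.
From mathcomp Require Import measurable_realfun ring lra.

Set Implicit Arguments.
Unset Strict Implicit.
Unset Printing Implicit Defensive.

Import Order.TTheory GRing.Theory Num.Theory.
Import numFieldNormedType.Exports.
Local Open Scope classical_set_scope.
Local Open Scope ring_scope.

(** The thresholds decouple. Once the balking state n0 is fixed, the weights
    q(n; n0) are fixed too, so each quote d_n with n < n0 can be optimized
    separately: the gain p - l L_n(d) grows with d, hence the best quote is the
    largest one that a customer accepts, d~_n. The supremum defining d~_n is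
    attained, because the expected utility is left-continuous in the quote
    ([d_tildeP]). With g n = G_n(d~_n), S n the sum of the rho^k for k <= n and
    W n the sum of the rho^k g k for k < n, this gives
    H(n0) = lambda W n0 / S n0 ([H_in_range]).

    Elementary algebra turns consecutive differences into A:
    H(n+1) - H(n) = lambda rho^n A(n) / (S n S(n+1)) ([threshold_valueS]) and
    A(n+1) - A(n) = (g(n+1) - g n) S(n+1) ([marginal_gainS]). So if g is
    nonincreasing then so is A, hence H increases as long as A is nonnegative
    and decreases afterwards; its maximum on the admissible range is at the
    first index where A is negative, clipped to that range.

    That g is nonincreasing comes from stochastic monotonicity: the ratio of
    the densities of X_(n+1) and X_n is increasing, so the expectation of any
    nondecreasing function increases with n ([gamma_stochastic_leS]). Since
    l <= c, the loss c x - l (x - d)^+ is nondecreasing in x; a fuller queue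
    therefore makes customers harder to please, so that d~_n decreases, while
    it increases the expected lateness of any given quote.

    It remains to see that the threshold is finite. From exp y >= 1 + y, a risk
    averse customer joins only if a risk neutral one would, that is
    c E X_n <= R - p + l L_n(d) ([mean_wait_le]), where E X_n = (n+1)/mu. For
    d = oo this bounds the states of the infinite quote, so n_low is finite;
    for d = d~_n it reads g n <= R - c (n+1)/mu, so that A(n) <= g n is
    eventually negative if all states accept the quote 0 (as when l = c). *)

(** * Integrals of real-valued functions *)

Section real_integrands.
Context (d : measure_display) (T : measurableType d) (K : realType).
Context (m : {measure set T -> \bar K}).
Implicit Types f g : T -> K.

Lemma ge0_integral_EFinD f g :
  measurable_fun setT f -> measurable_fun setT g ->
  (forall x, 0 <= f x) -> (forall x, 0 <= g x) ->
  (\int[m]_x (f x + g x)%:E = \int[m]_x (f x)%:E + \int[m]_x (g x)%:E)%E.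
Proof.
move=> mf mg f0 g0; under eq_integral do rewrite EFinD.
by apply: ge0_integralD => //;
  [move=> x _; rewrite lee_fin|exact/measurable_EFinP
  |move=> x _; rewrite lee_fin|exact/measurable_EFinP].
Qed.

Lemma ge0_integral_EFinZl (a : K) f :
  measurable_fun setT f -> 0 <= a -> (forall x, 0 <= f x) ->
  (\int[m]_x (a * f x)%:E = a%:E * \int[m]_x (f x)%:E)%E.
Proof.
move=> mf a0 f0; under eq_integral do rewrite EFinM.
by apply: ge0_integralZl_EFin => //;
  [move=> x _; rewrite lee_fin|exact/measurable_EFinP].
Qed.

Lemma ge0_le_integral_EFin f g :
  measurable_fun setT f -> measurable_fun setT g ->
  (forall x, 0 <= f x) -> (forall x, f x <= g x) ->
  (\int[m]_x (f x)%:E <= \int[m]_x (g x)%:E)%E.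
Proof.
move=> mf mg f0 fg.
by apply: ge0_le_integral => //;
  [move=> x _; rewrite lee_fin|exact/measurable_EFinP|exact/measurable_EFinP
  |move=> x _; rewrite lee_fin].
Qed.

Lemma integral_EFin_ge0 f :
  (forall x, 0 <= f x) -> (0 <= \int[m]_x (f x)%:E)%E.
Proof. by move=> f0; apply: integral_ge0 => x _; rewrite lee_fin. Qed.

(** Positive and negative parts are compared separately, so that infinite
    integrals are allowed on both sides. *)
Lemma le_integral_EFin f g :
  measurable_fun setT f -> measurable_fun setT g -> (forall x, f x <= g x) ->
  (\int[m]_x (f x)%:E <= \int[m]_x (g x)%:E)%E.
Proof.
move=> /measurable_EFinP mf /measurable_EFinP mg fg.
rewrite integralE [leRHS]integralE; apply: leeB.
- apply: ge0_le_integral => //; do ?exact: measurable_funepos.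
  by move=> x _; apply: (@funepos_le _ _ setT);
    rewrite ?in_setT // => y _; rewrite lee_fin.
- apply: ge0_le_integral => //; do ?exact: measurable_funeneg.
  by move=> x _; apply: (@funeneg_le _ _ setT);
    rewrite ?in_setT // => y _; rewrite lee_fin.
Qed.

End real_integrands.

Section expectation_of_nonnegative.
Context (d : measure_display) (T : measurableType d) (K : realType).
Local Open Scope ereal_scope.

(** The function g and the Radon-Nikodym derivative of nu have the same integral
    over every measurable set, hence agree almost everywhere; the change of
    variables known for the derivative thus holds for g. *)
Lemma ge0_integral_density (nu : {finite_measure set T -> \bar K})
    (m : {sigma_finite_measure set T -> \bar K}) (g h : T -> \bar K) :
  measurable_fun setT g ->
  (forall S, measurable S -> nu S = \int[m]_(x in S) g x) ->
  measurable_fun setT h -> (forall x, 0 <= h x) ->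
  \int[nu]_x h x = \int[m]_x (h x * g x).
Proof.
move=> mg nuE mh h0.
have num : nu `<< m.
  apply/null_content_dominatesP => S mS mS0; rewrite nuE//.
  by apply: null_set_integral => //; exact: measurable_funTS.
rewrite -(Radon_Nikodym_SigmaFinite.change_of_variables num h0 measurableT mh).
have iRN := Radon_Nikodym_SigmaFinite.f_integrable num.
apply: ae_eq_integral => //.
- by apply: emeasurable_funM => //; exact: measurable_int iRN.
- exact: emeasurable_funM.
apply: ae_eqe_mul2l; apply: integral_ae_eq => // E _ mE.
by rewrite -nuE// -Radon_Nikodym_SigmaFinite.f_integral.
Qed.

Lemma integral_probability_cst (P : probability T K) (a : K) :
  \int[P]_w a%:E = a%:E.
Proof. by rewrite integral_cst//= probability_setT mule1. Qed.

(** The integral of f may be infinite, so that linearity is not available for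
    a - f. With u and v the positive and negative parts of a - f, the identity
    f + u = a + v can be integrated since all its terms are nonnegative, and the
    integral of u, at most a, can be cancelled. *)
Lemma ge0_integral_const_sub (P : probability T K) (a : K) (f : T -> K) :
  (0 <= a)%R -> measurable_fun setT f -> (forall w, 0 <= f w)%R ->
  (0 <= \int[P]_w (a - f w)%:E) = (\int[P]_w (f w)%:E <= a%:E).
Proof.
move=> a0 mf f0.
pose u w := Num.max (a - f w)%R 0%R; pose v w := Num.max (f w - a)%R 0%R.
have mu_ : measurable_fun setT u.
  by apply: measurable_maxr => //; exact: measurable_funB.
have mv : measurable_fun setT v.
  by apply: measurable_maxr => //; exact: measurable_funB.
have u0 w : (0 <= u w)%R by rewrite le_max lexx orbT.
have v0 w : (0 <= v w)%R by rewrite le_max lexx orbT.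
have -> : \int[P]_w (a - f w)%:E = \int[P]_w (u w)%:E - \int[P]_w (v w)%:E.
  rewrite integralE; congr (_ - _); apply: eq_integral => w _.
    by rewrite funeposE /u EFin_max.
  by rewrite funenegE /v -EFinN opprB EFin_max.
have fu : \int[P]_w (f w)%:E + \int[P]_w (u w)%:E = a%:E + \int[P]_w (v w)%:E.
  rewrite -(integral_probability_cst P a) -!ge0_integral_EFinD//.
  apply: eq_integral => w _; congr (_%:E).
  rewrite /u /v; case: leP => ?; case: leP => ?; lra.
have ua : \int[P]_w (u w)%:E \is a fin_num.
  rewrite ge0_fin_numE; last exact: integral_EFin_ge0.
  apply: (@le_lt_trans _ _ a%:E); last by rewrite ltry.
  rewrite -[leRHS](integral_probability_cst P).
  apply: ge0_le_integral_EFin => //.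
  by move=> w; rewrite /u ge_max a0 andbT lerBlDr lerDl.
rewrite sube_ge0; last by rewrite ua ?orbT.
by rewrite -(leeD2rE _ a%:E ua) fu leeD2lE.
Qed.

End expectation_of_nonnegative.

(** * Gamma distributions *)

Section gamma.
Context (K : realType) (disp : measure_display) (T : measurableType disp).
Context (P : probability T K).
Implicit Types (X Y : {RV P >-> K}) (n : nat) (mu : K) (f h : K -> K).
Local Notation leb := (@lebesgue_measure K).

Lemma gamma_pdf_ge0 n mu x : 0 < mu -> 0 <= gamma_pdf n mu x.
Proof.
move=> mu0; rewrite /gamma_pdf; case: ifPn => // x0.
by rewrite divr_ge0// mulr_ge0 ?expR_ge0// mulr_ge0// exprn_ge0// ltW.
Qed.

Lemma measurable_gamma_pdf n mu : measurable_fun setT (@gamma_pdf K n mu).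
Proof.
have -> : @gamma_pdf K n mu = (fun x => \1_`]0, +oo[%classic x *
    (mu ^+ n.+1 * x ^+ n * expR (- (mu * x)) / n`!%:R)).
  apply/funext => x; rewrite /gamma_pdf indicE mem_setE in_itv/= andbT.
  by case: ifP => _; rewrite ?mul1r ?mul0r.
apply: measurable_funM => //.
apply: measurable_funM => //; apply: measurable_funM.
  by apply: measurable_funM => //; exact: measurable_funX.
by apply: measurableT_comp => //; apply: measurableT_comp.
Qed.

(** This recurrence gives the mean as well as the fact that the ratio of the
    densities of two consecutive shapes is increasing. *)
Lemma gamma_pdfS n mu x : 0 < mu ->
  x * gamma_pdf n mu x = n.+1%:R / mu * gamma_pdf n.+1 mu x.
Proof.
move=> mu0; rewrite /gamma_pdf; case: ifPn => _; last by rewrite !mulr0.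
have n0 : n.+1%:R != 0 :> K by rewrite pnatr_eq0.
have f0 : n`!%:R != 0 :> K by rewrite pnatr_eq0 -lt0n fact_gt0.
rewrite factS natrM (exprS x) (exprS mu n.+1); field.
by apply/and3P; split; rewrite ?lt0r_neq0 // addrC natr1.
Qed.

Lemma ge0_expectation_gamma X n mu h : 0 < mu ->
  gamma_distributed X n mu -> measurable_fun setT h -> (forall x, 0 <= h x) ->
  (\int[P]_w (h (X w))%:E = \int[leb]_x (h x * gamma_pdf n mu x)%:E)%E.
Proof.
move=> mu0 HX mh h0.
(* The Lebesgue measure lives on the type measurableTypeR K, which has the
   measurable sets of K but is a different structure. *)
have mX : measurable_fun setT (X : T -> measurableTypeR K).
  exact: (measurable_funPT X).
pose X' : {mfun T >-> measurableTypeR K} :=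
  HB.pack (X : T -> measurableTypeR K) (isMeasurableFun.Build _ _ _ _ _ mX).
have mE : @measurable_fun _ _ (measurableTypeR K) _ setT (EFin \o h).
  exact/measurable_EFinP.
have hE0 y : (0 <= (EFin \o h) y)%E by rewrite lee_fin.
rewrite -[LHS](ge0_integral_distribution X' mE hE0).
rewrite (@ge0_integral_density _ _ _ (distribution P X') leb
  (EFin \o gamma_pdf n mu) (EFin \o h))//.
by apply/measurable_EFinP; exact: measurable_gamma_pdf.
Qed.

Lemma integral_gamma_pdf X n mu : 0 < mu -> gamma_distributed X n mu ->
  (\int[leb]_x (gamma_pdf n mu x)%:E = 1)%E.
Proof.
move=> mu0 HX.
rewrite -(HX setT)// /distribution /pushforward preimage_setT.
exact: probability_setT.
Qed.

(** Instances at measurableTypeR K, stated with the measurability of functions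
    on K itself. *)
Let lebesgueD f h :
  measurable_fun setT f -> measurable_fun setT h ->
  (forall x, 0 <= f x) -> (forall x, 0 <= h x) ->
  (\int[leb]_x (f x + h x)%:E = \int[leb]_x (f x)%:E + \int[leb]_x (h x)%:E)%E.
Proof. exact: (@ge0_integral_EFinD _ (measurableTypeR K)). Qed.

Let lebesgueZl (a : K) f :
  measurable_fun setT f -> 0 <= a -> (forall x, 0 <= f x) ->
  (\int[leb]_x (a * f x)%:E = a%:E * \int[leb]_x (f x)%:E)%E.
Proof. exact: (@ge0_integral_EFinZl _ (measurableTypeR K)). Qed.

Let le_lebesgue f h :
  measurable_fun setT f -> measurable_fun setT h ->
  (forall x, 0 <= f x) -> (forall x, f x <= h x) ->
  (\int[leb]_x (f x)%:E <= \int[leb]_x (h x)%:E)%E.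
Proof. exact: (@ge0_le_integral_EFin _ (measurableTypeR K)). Qed.

(** Gamma variables are almost surely positive, so a comparison of f and h on
    the positive half-line suffices. *)
Lemma gamma_expectation_le X n mu f h : 0 < mu -> gamma_distributed X n mu ->
  measurable_fun setT f -> measurable_fun setT h ->
  (forall x, 0 <= f x) -> (forall x, 0 <= h x) ->
  (forall x, 0 < x -> f x <= h x) ->
  (\int[P]_w (f (X w))%:E <= \int[P]_w (h (X w))%:E)%E.
Proof.
move=> mu0 HX mf mh f0 h0 fh.
rewrite !(ge0_expectation_gamma mu0 HX)//.
have mg := measurable_gamma_pdf n mu.
have g0 x := gamma_pdf_ge0 n x mu0.
apply: le_lebesgue.
- exact: measurable_funM.
- exact: measurable_funM.
- by move=> x; rewrite mulr_ge0.
- move=> x; have [x0|x0] := ltP 0 x; first by rewrite ler_wpM2r// fh.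
  by rewrite /gamma_pdf ltNge x0 !mulr0.
Qed.

(** The densities of the two shapes cross once, at a = (n + 1) / mu, where also
    h - h a changes sign: the product of h - h a with the difference of the
    densities is nonnegative. Its integral is the difference of the two
    expectations, since both densities have total mass 1. *)
Lemma gamma_stochastic_leS X Y n mu h : 0 < mu ->
  gamma_distributed X n mu -> gamma_distributed Y n.+1 mu ->
  measurable_fun setT h -> (forall x, 0 <= h x) ->
  {homo h : x y / x <= y} ->
  (\int[P]_w (h (X w))%:E <= \int[P]_w (h (Y w))%:E)%E.
Proof.
move=> mu0 HX HY mh h0 hmono.
rewrite (ge0_expectation_gamma mu0 HX)// (ge0_expectation_gamma mu0 HY)//.
have mg k := measurable_gamma_pdf k mu.
have g0 k x := gamma_pdf_ge0 k x mu0.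
pose a : K := n.+1%:R / mu.
have a0 : 0 < a by rewrite divr_gt0.
have H1 (k : nat) (Z : {RV P >-> K}) : gamma_distributed Z k mu ->
    (\int[leb]_x (h a * gamma_pdf k mu x)%:E)%E = (h a)%:E.
  move=> HZ; rewrite (lebesgueZl (mg k) (h0 a) (g0 k)).
  by rewrite [X in (_ * X)%E](integral_gamma_pdf mu0 HZ) mule1.
(* The expectations may be infinite: h a is added on both sides, as the
   integral against either density, to compare sums of nonnegative terms. *)
rewrite -(@leeD2rE _ (h a)%:E)// -{1}(H1 _ _ HY) -(H1 _ _ HX).
have mhg k : measurable_fun setT (fun x => h x * gamma_pdf k mu x).
  exact: measurable_funM.
have hg0 k x : 0 <= h x * gamma_pdf k mu x by rewrite mulr_ge0.
have mag k : measurable_fun setT (fun x => h a * gamma_pdf k mu x).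
  exact: measurable_funM.
have ag0 k x : 0 <= h a * gamma_pdf k mu x by rewrite mulr_ge0.
rewrite -!lebesgueD//; apply: le_lebesgue.
- exact: measurable_funD.
- exact: measurable_funD.
- by move=> x; rewrite addr_ge0.
move=> x.
suff : 0 <= (h x - h a) * (gamma_pdf n.+1 mu x - gamma_pdf n mu x) by lra.
have E : a * (gamma_pdf n.+1 mu x - gamma_pdf n mu x) =
    (x - a) * gamma_pdf n mu x by rewrite mulrBr -gamma_pdfS// mulrBl.
have [xa|/ltW ax] := leP x a.
  apply: mulr_le0; first by rewrite subr_le0 hmono.
  by rewrite -(pmulr_rle0 _ a0) E mulr_le0_ge0// subr_le0.
apply: mulr_ge0; first by rewrite subr_ge0 hmono.
by rewrite -(pmulr_rge0 _ a0) E mulr_ge0// subr_ge0.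
Qed.

(** The variable Y is there to provide the total mass of the density of shape
    n + 2. The maximum with 0, almost surely harmless, makes the integrand
    nonnegative everywhere. *)
Lemma gamma_mean X Y n mu : 0 < mu ->
  gamma_distributed X n mu -> gamma_distributed Y n.+1 mu ->
  (\int[P]_w (Num.max (X w) 0)%:E = (n.+1%:R / mu)%:E)%E.
Proof.
move=> mu0 HX HY.
have mmax : measurable_fun setT (fun x : K => Num.max x 0).
  exact: measurable_maxr.
rewrite (ge0_expectation_gamma (h := fun x => Num.max x 0) mu0 HX)//; last first.
  by move=> x; rewrite le_max lexx orbT.
under eq_integral => x _.
  have -> : Num.max x 0 * gamma_pdf n mu x = n.+1%:R / mu * gamma_pdf n.+1 mu x.
    rewrite -gamma_pdfS//; case: ltP => // x0.
    by rewrite /gamma_pdf ltNge (ltW x0) !mulr0.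
  over.
rewrite lebesgueZl//.
- by rewrite [X in (_ * X)%E](integral_gamma_pdf mu0 HY) mule1.
- exact: measurable_gamma_pdf.
- by rewrite divr_ge0// ltW.
- by move=> x; exact: gamma_pdf_ge0.
Qed.

End gamma.

(** * Lateness and disutility of a waiting time *)

Section excess.
Context (K : realType).
Implicit Types (x y e : K) (d : \bar K).

Lemma excess_pinfty x : excess x +oo%E = 0.
Proof. by rewrite /excess [(_ - _)%E]/= maxNye. Qed.

Lemma excess_EFin x e : excess x e%:E = Num.max (x - e) 0.
Proof. by rewrite /excess -EFinB -EFin_max. Qed.

Lemma excess_ninfty x : excess x -oo%E = 0.
Proof. by rewrite /excess [(_ - _)%E]/= maxye. Qed.

Lemma excess_ge0 x d : 0 <= excess x d.
Proof.
case: d => [e| |]; rewrite ?excess_EFin ?excess_pinfty ?excess_ninfty//.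
by rewrite le_max lexx orbT.
Qed.

Lemma excess_antitone x d d' :
  (-oo < d)%E -> (d <= d')%E -> excess x d' <= excess x d.
Proof.
case: d => [e| |]//; case: d' => [e'| |]// _.
- rewrite lee_fin => ee; rewrite !excess_EFin.
  by have [?|?] := leP (x - e) 0; have [?|?] := leP (x - e') 0; lra.
- by rewrite excess_pinfty excess_ge0.
Qed.

Lemma excess_homo d : {homo (fun x => excess x d) : x y / x <= y}.
Proof.
move=> x y xy; case: d => [e| |]; rewrite ?excess_pinfty ?excess_ninfty//.
by rewrite !excess_EFin; have [?|?] := leP (x - e) 0;
  have [?|?] := leP (y - e) 0; lra.
Qed.

Lemma excess_lipschitz x y d : x <= y -> excess y d - excess x d <= y - x.
Proof.
move=> xy; case: d => [e| |];
  rewrite ?excess_pinfty ?excess_ninfty ?subr0 ?subr_ge0//.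
by rewrite !excess_EFin; have [?|?] := leP (x - e) 0;
  have [?|?] := leP (y - e) 0; lra.
Qed.

Lemma excess_le_max0 x d : (0 <= d)%E -> excess x d <= Num.max x 0.
Proof.
case: d => [e| |]//; rewrite ?lee_fin => e0; last first.
  by rewrite excess_pinfty le_max lexx orbT.
by rewrite excess_EFin; have [?|?] := leP (x - e) 0; have [?|?] := leP x 0; lra.
Qed.

Lemma measurable_excess d : measurable_fun setT (fun x => excess x d).
Proof.
case: d => [e| |].
- under eq_fun do rewrite excess_EFin.
  by apply: measurable_maxr => //; exact: measurable_funB.
- by under eq_fun do rewrite excess_pinfty; exact: measurable_cst.
- by under eq_fun do rewrite excess_ninfty; exact: measurable_cst.
Qed.

(** Provides one approximation from below for finite and infinite quotes alike:
    in the first case the excess is continuous in the quote, in the second it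
    is eventually 0. *)
Lemma excess_left_approx d : (-oo < d)%E -> exists u : K^nat,
  [/\ nondecreasing_seq u, forall k, ((u k)%:E < d)%E &
      forall x, excess x (u k)%:E @[k --> \oo] --> excess x d].
Proof.
case: d => [e| |]// _.
- exists (fun k => e - k.+1%:R^-1); split.
  + move=> i j ij; rewrite lerD2l lerN2 lef_pV2 ?posrE//.
    by rewrite ler_nat ltnS.
  + by move=> k; rewrite lte_fin ltrBlDr ltrDl invr_gt0.
  move=> x.
  apply: (@squeeze_cvgr _ _ _ _ (fun=> excess x e%:E)
     (fun k => excess x e%:E + k.+1%:R^-1)).
  + near=> k; have : 0 < k.+1%:R^-1 :> K by rewrite invr_gt0.
    rewrite !excess_EFin; set v := _^-1 => v0.
    by have [?|?] := leP (x - e) 0; have [?|?] := leP (x - (e - v)) 0; lra.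
  + exact: cvg_cst.
  + rewrite -[X in _ --> X]addr0; apply: cvgD; first exact: cvg_cst.
    exact: cvg_harmonic.
- exists (fun k => k%:R); split.
  + by move=> i j ij; rewrite ler_nat.
  + by move=> k; rewrite ltry.
  move=> x; rewrite excess_pinfty; apply: cvg_near_cst; near=> k.
  rewrite excess_EFin max_r// subr_le0.
  by near: k; exact: nbhs_infty_ger.
Unshelve. all: by end_near. Qed.

End excess.

(** Up to a positive factor and an additive constant, minus the exponential
    utility of a customer who waits x. It is nonnegative, so that its
    expectation always makes sense in the extended reals. *)
Definition wait_disutility (K : realType) (c l r : K) (d : \bar K)
    (x : K) : K :=
  expR (r * (c * x - l * excess x d)).

Section wait_disutility.
Context (K : realType) (c l r : K).
Hypotheses (r0 : 0 < r) (l0 : 0 <= l) (lc : l <= c).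
Local Notation phi := (wait_disutility c l r).

Lemma wait_disutility_ge0 d x : 0 <= phi d x.
Proof. exact: expR_ge0. Qed.

Lemma measurable_wait_disutility d : measurable_fun setT (phi d).
Proof.
apply: measurableT_comp => //; apply: measurable_funM => //.
apply: measurable_funB; first exact: measurable_funM.
by apply: measurable_funM => //; exact: measurable_excess.
Qed.

(** A longer wait is never compensated in full, because l <= c and the excess is
    1-Lipschitz. *)
Lemma wait_disutility_homo d : {homo phi d : x y / x <= y}.
Proof.
move=> x y xy; rewrite ler_expR ler_pM2l//.
have := ler_wpM2l l0 (excess_lipschitz d xy).
have : l * (y - x) <= c * (y - x) by rewrite ler_wpM2r// subr_ge0.
by lra.
Qed.

Lemma wait_disutility_quote_le d d' x :
  (-oo < d)%E -> (d <= d')%E -> phi d x <= phi d' x.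
Proof.
move=> dNy dd'; rewrite ler_expR ler_pM2l// lerD2l lerN2 ler_wpM2l//.
exact: excess_antitone.
Qed.

(** Monotone convergence along quotes increasing to d. The expectation can jump
    to +oo at an infinite quote, but this is still its left limit. *)
Lemma expectation_wait_disutility_left (disp : measure_display)
    (T : measurableType disp) (P : {measure set T -> \bar K}) (X : T -> K)
    (d : \bar K) (C : \bar K) :
  measurable_fun setT X -> (-oo < d)%E ->
  (forall e : K, (e%:E < d)%E -> (\int[P]_w (phi e%:E (X w))%:E <= C)%E) ->
  (\int[P]_w (phi d (X w))%:E <= C)%E.
Proof.
move=> mX dNy leC; have [u [u_nd u_d u_cvg]] := excess_left_approx dNy.
pose g k w := (phi (u k)%:E (X w))%:E.
have phi_cvg w : g k w @[k --> \oo] --> (phi d (X w))%:E.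
  apply/fine_cvgP; split; first exact: nearW.
  have expR_cvg :
      {for r * (c * X w - l * excess (X w) d), continuous (@expR K)}.
    exact: continuous_expR.
  apply: (continuous_cvg _ expR_cvg); apply: cvgMl_tmp.
  by apply: (cvgB (cvg_cst _)); apply: cvgMl_tmp; exact: u_cvg.
have -> : (\int[P]_w (phi d (X w))%:E = \int[P]_w (limn (g ^~ w)))%E.
  by apply: eq_integral => w _; apply/esym/cvg_lim.
have mg k : measurable_fun setT (g k).
  apply/measurable_EFinP; apply: measurableT_comp => //.
  exact: measurable_wait_disutility.
have g0 k w : setT w -> (0 <= g k w)%E by rewrite lee_fin wait_disutility_ge0.
have g_nd w : setT w -> {homo g ^~ w : m n / (m <= n)%N >-> (m <= n)%E}.
  move=> _ m n mn; rewrite lee_fin; apply: wait_disutility_quote_le.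
    exact: ltNyr.
  by rewrite lee_fin u_nd.
have := cvg_monotone_convergence (mu := P) measurableT mg g0 g_nd.
move=> /[dup] /cvgP gcvg /cvg_lim <-//; apply: lime_le => //.
by apply: nearW => k; apply: leC.
Qed.

End wait_disutility.

(** * Expected utility, joining customers and gains *)

Section expectations_of_the_queue.
Context (K : realType) (disp : measure_display) (T : measurableType disp).
Context (P : probability T K) (X : nat -> {RV P >-> K}).
Context (mu R p c l r : K).
Hypotheses (mu0 : 0 < mu) (c0 : 0 < c) (r0 : 0 < r) (l0 : 0 <= l) (lc : l <= c).
Hypothesis (pR : p <= R).
Hypothesis (hX : forall n : nat, gamma_distributed (X n) n mu).
Implicit Types (n m : nat) (d e : \bar K).

Local Notation phi := (wait_disutility c l r).
Local Notation B := (utility X R p c l r).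
Local Notation dP := (d_tilde X R p c l r).
Local Notation G := (gain X R p c l r).

Let mphi d n : measurable_fun setT (fun w => phi d (X n w)).
Proof. exact: (measurableT_comp (measurable_wait_disutility c l r d)). Qed.

Let mexc d n : measurable_fun setT (fun w => excess (X n w) d).
Proof. exact: (measurableT_comp (measurable_excess d)). Qed.

Lemma utilityE n d : B n d =
  (\int[P]_w (r^-1 - expR (- (r * (R - p))) / r * phi d (X n w))%:E)%E.
Proof.
rewrite /utility unlock; apply: eq_integral => w _; congr (_%:E).
rewrite /wait_disutility mulrAC -expRD mulrBl mul1r; congr (_ - expR _ / r).
by ring.
Qed.

(** Trades the expectation of a function unbounded below for that of a
    nonnegative one, on which all later comparisons are made. *)
Lemma utility_ge0 n d : (0 <= B n d)%E =
  (\int[P]_w (phi d (X n w))%:E <= (expR (r * (R - p)))%:E)%E.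
Proof.
have k0 : 0 < expR (- (r * (R - p))) / r by rewrite divr_gt0// expR_gt0.
rewrite utilityE ge0_integral_const_sub.
- rewrite ge0_integral_EFinZl//.
  + rewrite -lee_pdivlMl// -EFinM invf_div expRN invrK mulrAC divff ?mul1r//.
    by rewrite gt_eqF.
  + exact: ltW.
  + by move=> w; exact: wait_disutility_ge0.
- by rewrite invr_ge0 ltW.
- exact: measurable_funM.
- by move=> w; rewrite mulr_ge0 ?wait_disutility_ge0// ltW.
Qed.

Lemma utility_quote_le n d e : (-oo < d)%E -> (d <= e)%E -> (B n e <= B n d)%E.
Proof.
move=> dNy de; rewrite !utilityE; apply: le_integral_EFin.
- by apply: measurable_funB => //; exact: measurable_funM.
- by apply: measurable_funB => //; exact: measurable_funM.
- move=> w; rewrite lerD2l lerN2 ler_wpM2l//.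
    by rewrite divr_ge0 ?expR_ge0// ltW.
  exact: wait_disutility_quote_le.
Qed.

Lemma utility_left n d : (-oo < d)%E ->
  (forall e : K, (e%:E < d)%E -> (0 <= B n e%:E)%E) -> (0 <= B n d)%E.
Proof.
move=> dNy Be; rewrite utility_ge0.
apply: expectation_wait_disutility_left => //.
by move=> e ed; rewrite -utility_ge0; exact: Be.
Qed.

(** By monotonicity the limit is the infimum over real quotes, and by
    left-continuity at the infinite quote the utility is nonnegative there as
    soon as it is at all real quotes. *)
Lemma lim_utility_lt0 n :
  (lim (B n x%:E @[x --> +oo%R]) < 0)%E = (B n +oo < 0)%E.
Proof.
have Bni : {homo (fun x : K => B n x%:E) : x y / x <= y >-> (y <= x)%E}.
  by move=> x y xy; rewrite utility_quote_le ?ltNyr ?lee_fin.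
have /cvg_lim -> // := nonincreasing_cvge Bni.
apply/idP/idP.
- move=> /ereal_inf_lt[_ [x _ <-]]; apply: le_lt_trans.
  by rewrite utility_quote_le ?ltNyr ?leey.
- rewrite !ltNge; apply: contra => inf0; apply: utility_left => // e _.
  by rewrite (le_trans inf0)//; apply: ereal_inf_lbound; exists e.
Qed.

(** The disutility is nondecreasing in the waiting time, which grows
    stochastically with the state. *)
Lemma utility_state_ge0 n m d : (n <= m)%N -> (0 <= B m d)%E -> (0 <= B n d)%E.
Proof.
move=> /subnK <-; elim: (m - n)%N => // k IH; rewrite addSn => H.
apply: IH; move: H; rewrite !utility_ge0; apply: le_trans.
apply: (gamma_stochastic_leS (h := phi d) mu0 (hX _) (hX _)).
- exact: measurable_wait_disutility.
- exact: wait_disutility_ge0.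
- exact: wait_disutility_homo.
Qed.

Lemma latenessE n d : lateness X n d = (\int[P]_w (excess (X n w) d)%:E)%E.
Proof. by rewrite /lateness unlock. Qed.

Let mmax0 n : measurable_fun setT (fun w => Num.max (X n w) 0).
Proof. exact: measurable_maxr. Qed.

Let max0_ge0 n w : 0 <= Num.max (X n w) 0.
Proof. by rewrite le_max lexx orbT. Qed.

Lemma lateness_fin_num n d : (0 <= d)%E -> lateness X n d \is a fin_num.
Proof.
move=> d0; rewrite latenessE ge0_fin_numE; last first.
  by apply: integral_EFin_ge0 => w; exact: excess_ge0.
apply: (@le_lt_trans _ _ (n.+1%:R / mu)%:E); last by rewrite ltry.
rewrite -(gamma_mean mu0 (hX n) (hX n.+1)).
apply: ge0_le_integral_EFin => //.
- by move=> w; exact: excess_ge0.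
- by move=> w; exact: excess_le_max0.
Qed.

Lemma lateness_quote_le n d e : (0 <= d)%E -> (d <= e)%E ->
  fine (lateness X n e) <= fine (lateness X n d).
Proof.
move=> d0 de; apply: fine_le; rewrite ?lateness_fin_num// ?(le_trans d0)//.
rewrite !latenessE; apply: ge0_le_integral_EFin => //.
- by move=> w; exact: excess_ge0.
- by move=> w; rewrite excess_antitone// (lt_le_trans _ d0) ?ltNyr.
Qed.

Lemma lateness_stateS n d : (0 <= d)%E ->
  fine (lateness X n d) <= fine (lateness X n.+1 d).
Proof.
move=> d0; apply: fine_le; rewrite ?lateness_fin_num// !latenessE.
apply: (gamma_stochastic_leS (h := fun x => excess x d) mu0 (hX _) (hX _)).
- exact: measurable_excess.
- by move=> x; exact: excess_ge0.
- exact: excess_homo.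
Qed.

(** A risk averse customer who joins would also join if risk neutral: integrate
    exp y >= 1 + y for y = - r (R - p) + r (c x - l (x - d)^+). *)
Lemma mean_wait_le n d : (0 <= d)%E -> (0 <= B n d)%E ->
  c * (n.+1%:R / mu) <= R - p + l * fine (lateness X n d).
Proof.
move=> d0; rewrite utility_ge0 => Mle.
pose k := expR (- (r * (R - p))).
have k0 : 0 < k by exact: expR_gt0.
have kM : (k%:E * \int[P]_w (phi d (X n w))%:E <= 1)%E.
  by rewrite -lee_pdivlMl// mule1 -expRN opprK.
have rR : 0 <= r * (R - p) by rewrite mulr_ge0 ?subr_ge0// ltW.
have rl : 0 <= r * l by rewrite mulr_ge0// ltW.
have rc : 0 <= r * c by rewrite mulr_ge0// ltW.
have mexp : measurable_fun setT (fun x => k * phi d x).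
  by apply: measurable_funM => //; exact: measurable_wait_disutility.
have mexcs : measurable_fun setT (fun x => r * l * excess x d).
  by apply: measurable_funM => //; exact: measurable_excess.
have mpos : measurable_fun setT (fun x : K => r * c * Num.max x 0).
  by apply: measurable_funM => //; exact: measurable_maxr.
have max0 (x : K) : 0 <= Num.max x 0 by rewrite le_max lexx orbT.
have kphi0 x : 0 <= k * phi d x by rewrite mulr_ge0 ?wait_disutility_ge0// ltW.
have rle0 x : 0 <= r * l * excess x d by rewrite mulr_ge0 ?excess_ge0.
(* The inequality 1 + y <= exp y with the terms moved so that both sides are
   nonnegative. *)
have : (\int[P]_w (1 + r * c * Num.max (X n w) 0)%:E <=
    \int[P]_w (k * phi d (X n w) + (r * l * excess (X n w) d + r * (R - p)))%:E)%E.
  apply: (gamma_expectation_le (f := fun x => 1 + r * c * Num.max x 0)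
    (h := fun x => k * phi d x + (r * l * excess x d + r * (R - p))) mu0 (hX n)).
  - exact: measurable_funD.
  - by apply: measurable_funD => //; exact: measurable_funD.
  - by move=> x; rewrite addr_ge0// mulr_ge0.
  - by move=> x; rewrite !addr_ge0.
  - move=> x x0; rewrite max_l; last exact: ltW.
    have := expR_ge1Dx (- (r * (R - p)) + r * (c * x - l * excess x d)).
    by rewrite expRD -/k -/(phi d x); lra.
have mpX : measurable_fun setT (fun w => r * c * Num.max (X n w) 0).
  exact: measurable_funM.
have mkX : measurable_fun setT (fun w => k * phi d (X n w)).
  exact: measurable_funM.
have meX : measurable_fun setT (fun w => r * l * excess (X n w) d).
  exact: measurable_funM.
rewrite ge0_integral_EFinD//; last by move=> w; rewrite mulr_ge0.
rewrite ge0_integral_EFinD//; last 2 first.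
- exact: measurable_funD.
- by move=> w; rewrite addr_ge0.
rewrite ge0_integral_EFinD//.
have exc0 w : 0 <= excess (X n w) d by exact: excess_ge0.
rewrite (ge0_integral_EFinZl _ (mmax0 n) rc (max0_ge0 n)).
rewrite (ge0_integral_EFinZl _ (mexc d n) rl exc0).
rewrite (ge0_integral_EFinZl _ (mphi d n) (ltW k0)); last first.
  by move=> w; exact: wait_disutility_ge0.
rewrite !integral_probability_cst (gamma_mean mu0 (hX n) (hX n.+1)) -latenessE.
rewrite -(fineK (lateness_fin_num n d0)) -!EFinM -!EFinD => /le_trans H.
have : ((1 + r * c * (n.+1%:R / mu))%:E <=
    1 + (r * l * fine (lateness X n d) + r * (R - p))%:E)%E.
  by apply: H; rewrite leeD2r.
rewrite -EFinD lee_fin lerD2l => {}H.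
rewrite -(ler_pM2l r0); lra.
Qed.

(** If the quote 0 is acceptable then the supremum is over a nonempty set, and
    it is attained by left-continuity of the utility. *)
Lemma d_tildeP n : (0 <= B n 0)%E ->
  [/\ (0 <= dP n)%E, (0 <= B n (dP n))%E &
      forall d, (0 <= d)%E -> (0 <= B n d)%E -> (d <= dP n)%E].
Proof.
move=> B0; rewrite /d_tilde; set S := [set d | _].
have S0 : S 0%E by [].
rewrite asboolF; last first.
  by move=> SE; have : (set0 : set \bar K) 0%E by rewrite -SE.
have sup0 : (0 <= ereal_sup S)%E by exact: ereal_sup_ubound.
split => //; last by move=> d d0 Bd; exact: ereal_sup_ubound.
apply: utility_left; first exact: lt_le_trans sup0.
move=> e /ereal_sup_gt[d [d0 Bd] ed]; apply: le_trans Bd _.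
by rewrite utility_quote_le ?ltNyr ?ltW.
Qed.

Lemma gain_joinE n d : (0 <= B n d)%E -> G n d = p - l * fine (lateness X n d).
Proof. by rewrite /gain => ->. Qed.

(** Among the quotes that a customer accepts, a larger one means a smaller
    expected compensation. *)
Lemma gain_le_d_tilde n d : (0 <= d)%E -> (0 <= B n d)%E -> G n d <= G n (dP n).
Proof.
move=> d0 Bd; have B0 : (0 <= B n 0)%E.
  by rewrite (le_trans Bd)// utility_quote_le.
have [dn0 Bdn le_dn] := d_tildeP B0.
rewrite !gain_joinE// lerD2l lerN2 ler_wpM2l// lateness_quote_le//.
exact: le_dn.
Qed.

(** The best quote of state n + 1 is acceptable in state n, where it is also
    less often exceeded. *)
Lemma gain_d_tildeS n : (0 <= B n.+1 0)%E -> G n.+1 (dP n.+1) <= G n (dP n).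
Proof.
move=> BS0; have [dS0 BdS _] := d_tildeP BS0.
have BdSn := utility_state_ge0 (leqnSn n) BdS.
apply: le_trans (gain_le_d_tilde dS0 BdSn).
by rewrite !gain_joinE// lerD2l lerN2 ler_wpM2l// lateness_stateS.
Qed.

(** Bounds the gains by a sequence tending to -oo; this is what stops the search
    for a threshold when all states accept the quote 0. *)
Lemma gain_d_tilde_le n : (0 <= B n 0)%E ->
  G n (dP n) <= R - c * (n.+1%:R / mu).
Proof.
move=> B0; have [d0 Bd _] := d_tildeP B0.
by rewrite gain_joinE//; have := mean_wait_le d0 Bd; lra.
Qed.

Lemma utility_pinfty_lt0 n : R - p < c * (n.+1%:R / mu) -> (B n +oo < 0)%E.
Proof.
rewrite !ltNge; apply: contra => B0; have := mean_wait_le (leey 0%E) B0.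
rewrite latenessE.
by under eq_integral do rewrite excess_pinfty; rewrite integral0 mulr0 addr0.
Qed.

End expectations_of_the_queue.

(** * Minima of sets of natural numbers *)

Section nat_inf.
Context (K : realType).
Implicit Types (S : set nat) (m k : nat).

Lemma nat_infP S :
  (S = set0 /\ nat_inf K S = +oo%E) \/
  (exists k, [/\ S k, forall m, S m -> (k <= m)%N & nat_inf K S = k%:R%:E]).
Proof.
have [[i Si]|S0] := pselect (exists i, S i); last first.
  have -> : S = set0 by rewrite -subset0 => i Si; apply: S0; exists i.
  by left; split => //; rewrite /nat_inf image_set0 ereal_inf0.
right; have exS : exists k, `[< S k >] by exists i; apply/asboolP.
case: (ex_minnP exS) => k /asboolP Sk kmin; exists k.
have {}kmin m : S m -> (k <= m)%N by move=> Sm; apply: kmin; apply/asboolP.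
split => //; apply/eqP; rewrite eq_le; apply/andP; split.
  by apply: ereal_inf_lbound; exists k.
by apply: le_ereal_inf_tmp => _ [m Sm <-]; rewrite lee_fin ler_nat kmin.
Qed.

Lemma nat_inf_geP S m :
  (m%:R%:E <= nat_inf K S)%E <-> (forall k, S k -> (m <= k)%N).
Proof.
have [[-> ->]|[k [Sk kmin ->]]] := nat_infP S;
  first by split => // _; exact: leey.
rewrite lee_fin ler_nat; split => [mk j /kmin|]; first exact: leq_trans.
exact.
Qed.

Lemma nat_inf_gtP S m :
  (m%:R%:E < nat_inf K S)%E <-> (forall k, S k -> (m < k)%N).
Proof.
have [[-> ->]|[k [Sk kmin ->]]] := nat_infP S;
  first by split => // _; exact: ltry.
rewrite lte_fin ltr_nat; split => [mk j /kmin|]; first exact: leq_trans.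
exact.
Qed.

End nat_inf.

(** * Revenue as a function of the threshold *)

Section threshold_values.
Context (K : realType) (lambda rho : K) (g : nat -> K).
Hypotheses (lambda0 : 0 < lambda) (rho0 : 0 < rho).

Definition geometric_sum (n : nat) : K := \sum_(k < n.+1) rho ^+ k.
Definition gain_sum (n : nat) : K := \sum_(k < n) rho ^+ k * g k.
(** The revenue rate when g k is the expected payment of a customer arriving in
    state k: the stationary law of the queue truncated at n is proportional to
    rho ^+ k. *)
Definition threshold_value (n : nat) : K :=
  lambda * (gain_sum n / geometric_sum n).
(** The function A of the statement, for an arbitrary sequence of payments. *)
Definition marginal_gain (n : nat) : K :=
  g n * geometric_sum n - rho * gain_sum n.

Local Notation S := geometric_sum.
Local Notation W := gain_sum.
Local Notation V := threshold_value.
Local Notation a := marginal_gain.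

Lemma geometric_sumS n : S n.+1 = S n + rho ^+ n.+1.
Proof. by rewrite /geometric_sum big_ord_recr. Qed.

Lemma gain_sumS n : W n.+1 = W n + rho ^+ n * g n.
Proof. by rewrite /gain_sum big_ord_recr. Qed.

Lemma geometric_sum_ge1 n : 1 <= S n.
Proof.
elim: n => [|n IH]; first by rewrite /geometric_sum big_ord1 expr0.
by rewrite geometric_sumS (le_trans IH)// lerDl exprn_ge0// ltW.
Qed.

Lemma geometric_sum_gt0 n : 0 < S n.
Proof. exact: lt_le_trans (geometric_sum_ge1 n). Qed.

Lemma threshold_valueS n :
  V n.+1 - V n = lambda * rho ^+ n * a n / (S n * S n.+1).
Proof.
have Sn := lt0r_neq0 (geometric_sum_gt0 n).
have SSn := lt0r_neq0 (geometric_sum_gt0 n.+1).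
rewrite /threshold_value /marginal_gain gain_sumS.
have := geometric_sumS n; rewrite exprS => E.
by move: SSn; rewrite E => SSn; field; rewrite Sn SSn.
Qed.

Lemma threshold_value_leS n : 0 <= a n -> V n <= V n.+1.
Proof.
move=> an; rewrite -subr_ge0 threshold_valueS divr_ge0//.
  by rewrite !mulr_ge0// ?exprn_ge0// ltW.
by rewrite mulr_ge0// ltW// geometric_sum_gt0.
Qed.

Lemma threshold_value_geS n : a n <= 0 -> V n.+1 <= V n.
Proof.
move=> an; rewrite -subr_le0 threshold_valueS mulr_le0_ge0//.
  by rewrite mulr_ge0_le0// mulr_ge0 ?exprn_ge0// ltW.
by rewrite invr_ge0 mulr_ge0// ltW// geometric_sum_gt0.
Qed.

Lemma marginal_gainS n : a n.+1 - a n = (g n.+1 - g n) * S n.+1.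
Proof.
by rewrite /marginal_gain gain_sumS geometric_sumS exprS; ring.
Qed.

(** For nonincreasing g, each increment (g n.+1 - g n) * S n.+1 of a is at most
    the increment of g, as S is at least 1; and a and g agree at 0. *)
Lemma marginal_gain_le n : (forall k, (k < n)%N -> g k.+1 <= g k) -> a n <= g n.
Proof.
elim: n => [|n IH] gd.
  by rewrite /marginal_gain /gain_sum big_ord0 mulr0 subr0
    /geometric_sum big_ord1 expr0 mulr1.
have {}IH : a n <= g n by apply: IH => k kn; apply: gd; rewrite (ltn_trans kn).
have gn : g n.+1 - g n <= 0 by rewrite subr_le0 gd.
have := geometric_sum_ge1 n.+1; have := marginal_gainS n; nra.
Qed.

Lemma le_threshold_value m n : (m <= n)%N ->
  (forall k, (m <= k < n)%N -> 0 <= a k) -> V m <= V n.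
Proof.
move=> /subnK <-; elim: (n - m)%N => // k IH ak; rewrite addSn.
apply: (le_trans (IH _)).
  by move=> j /andP[mj jk]; apply: ak; rewrite mj addSn ltnS ltnW.
by apply: threshold_value_leS; apply: ak; rewrite leq_addl addSn ltnSn.
Qed.

Lemma ge_threshold_value m n : (m <= n)%N ->
  (forall k, (m <= k < n)%N -> a k <= 0) -> V n <= V m.
Proof.
move=> /subnK <-; elim: (n - m)%N => // k IH ak; rewrite addSn.
apply: le_trans (IH _).
  by apply: threshold_value_geS; apply: ak; rewrite leq_addl addSn ltnSn.
by move=> j /andP[mj jk]; apply: ak; rewrite mj addSn ltnS ltnW.
Qed.

Lemma marginal_gain_homo m n : (m <= n)%N ->
  (forall k, (m <= k < n)%N -> g k.+1 <= g k) -> a n <= a m.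
Proof.
move=> /subnK <-; elim: (n - m)%N => // k IH gk; rewrite addSn.
apply: le_trans (IH _).
  rewrite -subr_le0 marginal_gainS mulr_le0_ge0 ?subr_le0//.
    by apply: gk; rewrite leq_addl addSn ltnSn.
  by rewrite ltW// geometric_sum_gt0.
by move=> j /andP[mj jk]; apply: gk; rewrite mj addSn ltnS ltnW.
Qed.

End threshold_values.

Section value_of_a_threshold.
Context (K : realType) (disp : measure_display) (T : measurableType disp).
Context (P : probability T K) (X : nat -> {RV P >-> K}).
Context (lambda mu R p c l r : K).
Hypotheses (lambda0 : 0 < lambda) (mu0 : 0 < mu) (r0 : 0 < r).
Hypotheses (l0 : 0 <= l) (lc : l <= c).
Hypothesis (hX : forall n : nat, gamma_distributed (X n) n mu).

Local Notation B := (utility X R p c l r).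
Local Notation dP := (d_tilde X R p c l r).
Local Notation G := (gain X R p c l r).
Local Notation g := (fun n => G n (dP n)).
Local Notation rho := (lambda / mu).

Lemma n_lowE : n_low X R p c l r = nat_inf K [set n | (B n +oo < 0)%E].
Proof.
congr (nat_inf K _); apply/funext => n; apply/propext => /=.
by rewrite lim_utility_lt0.
Qed.

Lemma sum_q m (f : nat -> K) :
  \sum_(i < m.+1 | (i < m)%N) q lambda mu i m * f i =
  gain_sum rho f m / geometric_sum rho m.
Proof.
rewrite -(big_ord_widen m.+1 (fun i => q lambda mu i m * f i))//.
by rewrite /gain_sum mulr_suml; apply: eq_bigr => i _; rewrite mulrAC.
Qed.

(** Every joining state contributes with a nonnegative weight, so that all its
    quotes may be replaced by the best one; the infinite quote induces balking
    in state m. *)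
Lemma H_in_range m : (B m +oo < 0)%E ->
  (forall k, (k < m)%N -> (0 <= B k 0)%E) ->
  H X lambda mu R p c l r m = (threshold_value lambda rho g m)%:E.
Proof.
move=> Bm Bk; apply/eqP; rewrite eq_le; apply/andP; split.
- apply: ge_ereal_sup => _ [d [d0 dB _] <-]; rewrite lee_fin ler_pM2l//.
  rewrite -sum_q; apply: ler_sum => i im; rewrite ler_wpM2l//.
    rewrite divr_ge0//; first by rewrite exprn_ge0// ltW// divr_gt0.
    by rewrite sumr_ge0// => j _; rewrite exprn_ge0// ltW// divr_gt0.
  by apply: (gain_le_d_tilde mu0) => //; exact: dB.
- apply: ereal_sup_ubound.
  exists (fun i : 'I_m.+1 => if (i < m)%N then dP i else +oo%E).
    split => [i|i im|]; last by rewrite ltnn.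
      case: ifPn => [im|_]; last exact: leey.
      by have [] := d_tildeP r0 l0 (Bk _ im).
    by rewrite im; have [] := d_tildeP r0 l0 (Bk _ im).
  congr (_%:E); rewrite /threshold_value -sum_q; congr (lambda * _).
  by apply: eq_bigr => i im; rewrite im.
Qed.

End value_of_a_threshold.

(** * Optimality of the threshold *)

Theorem proposition3 (K : realType) (disp : measure_display)
    (T : measurableType disp) (P : probability T K) (X : nat -> {RV P >-> K})
    (lambda mu R p c l r : K)
    (hlambda : 0 < lambda) (hmu : 0 < mu) (hc : 0 < c) (hr : 0 < r)
    (hp0 : 0 <= p) (hpR : p <= R) (hl0 : 0 <= l) (hlc : l <= c)
    (hX : forall n : nat, gamma_distributed (X n) n mu) :
  exists nP : nat,
    n_P X lambda mu R p c l r = nP%:R%:E /\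
    optimal_threshold X lambda mu R p c l r nP.
Proof.
have rho0 : 0 < lambda / mu by rewrite divr_gt0.
pose B := utility X R p c l r.
pose g n := gain X R p c l r n (d_tilde X R p c l r n).
pose a := marginal_gain (lambda / mu) g.
pose openS n := (0 <= B n 0)%E.
have open_le k m : (k <= m)%N -> openS m -> openS k.
  by move=> km; exact: (utility_state_ge0 hmu hr hl0 hlc hX km).
have gS k : openS k.+1 -> g k.+1 <= g k.
  exact: (gain_d_tildeS hmu hr hl0 hlc hX).
have BooB n : (B n +oo <= B n 0)%E by exact: utility_quote_le.
have large (x : K) : exists n : nat, x < c * (n.+1%:R / mu).
  have cmu0 : 0 < c / mu by rewrite divr_gt0.
  exists (Num.bound `|x / (c / mu)|).
  rewrite mulrCA -ltr_pdivrMr//.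
  apply: le_lt_trans (ler_norm _) _; apply: lt_trans (archi_boundP _) _ => //.
  by rewrite ltr_nat.
have [low [low_lt0 low_min lowE]] : exists k, [/\ (B k +oo < 0)%E,
    forall m, (B m +oo < 0)%E -> (k <= m)%N & n_low X R p c l r = k%:R%:E].
  rewrite (n_lowE X R p c hr hl0).
  have [[L0 _]|//] := nat_infP K [set n | (B n +oo < 0)%E].
  have [n /(utility_pinfty_lt0 hmu hc hr hl0 hpR hX) Bn] := large (R - p).
  by have : (set0 : set nat) n by rewrite -L0.
have openP m : (m%:R%:E <= n_high X R p c l r)%E <->
    forall k, (k < m)%N -> openS k.
  rewrite /n_high; split => [/nat_inf_geP H k km|H].
    by rewrite /openS leNgt; apply/negP => /H; rewrite leqNgt km.
  apply/nat_inf_geP => k Bk; rewrite leqNgt; apply/negP => /H.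
  by rewrite /openS leNgt Bk.
have low_high m : (B m 0 < 0)%E -> (low <= m)%N.
  by move=> Bm; apply: low_min; apply: le_lt_trans Bm.
have a_homo i j : (i <= j)%N -> openS j -> a j <= a i.
  move=> ij oj; apply: (marginal_gain_homo rho0 ij) => k /andP[_ kj].
  by apply: gS; exact: open_le oj.
(* t is the first state where A becomes negative or that rejects the quote 0,
   whichever comes first. *)
have [t [tE t_open t_ge0 t_stop]] : exists t : nat,
    [/\ mine (n_tilde X lambda mu R p c l r) (n_high X R p c l r) = t%:R%:E,
        forall k, (k < t)%N -> openS k,
        forall k, (k < t)%N -> 0 <= a k &
        openS t -> a t < 0].
  rewrite /n_tilde; set Nh := n_high _ _ _ _ _ _.
  set St := [set n0 | _ /\ _].
  have Nh_lt k : (k%:R%:E < Nh)%E <-> openS k.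
    split => [/nat_inf_gtP Nk|ok].
      by rewrite /openS leNgt; apply/negP => /Nk; rewrite ltnn.
    apply/nat_inf_gtP => m Bm; rewrite ltnNge; apply/negP => mk.
    by have := open_le _ _ mk ok; rewrite /openS leNgt Bm.
  have [[St0 ->]|[t [[tN at0] tmin ->]]] := nat_infP K St.
    have a_ge0 k : openS k -> 0 <= a k.
      move=> ok; rewrite leNgt; apply/negP => ak.
      by have : (set0 : set nat) k by rewrite -St0; split => //; exact/Nh_lt.
    rewrite minye.
    (* If A were never negative and all states accepted the quote 0, then the
       bound A n <= g n would contradict g n -> -oo. *)
    have [[Nh0 NhE]|[t [Bt tmin NhE]]] := nat_infP K [set n | (B n 0 < 0)%E].
      have all_open n : openS n by apply/Nh_lt; rewrite /Nh /n_high NhE ltry.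
      have [n Rn] := large R.
      have := a_ge0 n (all_open n).
      have : a n <= g n.
        by apply: (marginal_gain_le rho0) => k _; exact: gS (all_open _).
      have := gain_d_tilde_le hmu hc hr hl0 hpR hX (all_open n).
      by rewrite -/(g n); lra.
    have t_open k : (k < t)%N -> openS k.
      by move=> kt; apply/Nh_lt; rewrite /Nh /n_high NhE lte_fin ltr_nat.
    exists t; split => // [k /t_open/a_ge0//|].
    by rewrite /openS leNgt Bt.
  rewrite min_l ?ltW//; exists t; split => //.
  - by move=> k kt; apply/Nh_lt; apply: lt_trans tN; rewrite lte_fin ltr_nat.
  - move=> k kt; rewrite leNgt; apply/negP => ak.
    have : (t <= k)%N.
      by apply: tmin; split => //; apply: lt_trans tN; rewrite lte_fin ltr_nat.
    by rewrite leqNgt kt.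
pose N := maxn low t.
have N_open k : (k < N)%N -> openS k.
  rewrite leq_max => /orP[klow|]; last exact: t_open.
  by rewrite /openS leNgt; apply/negP => /low_high; rewrite leqNgt klow.
have range_val m : in_range X R p c l r m -> [/\ (low <= m)%N,
    forall k, (k < m)%N -> openS k &
    H X lambda mu R p c l r m = (threshold_value lambda (lambda / mu) g m)%:E].
  rewrite /in_range lowE => -[]; rewrite lee_fin ler_nat => lowm /openP mopen.
  split => //; apply: H_in_range => //.
  rewrite ltNge; apply/negP => /(utility_state_ge0 hmu hr hl0 hlc hX lowm).
  by rewrite leNgt low_lt0.
have N_range : in_range X R p c l r N.
  split; last exact/openP.
  by rewrite lowE lee_fin ler_nat leq_maxl.
exists N; split.
  by rewrite /n_P lowE tE -EFin_max -natr_max.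
split => // m /range_val[lowm mopen ->].
have [_ _ ->] := range_val _ N_range; rewrite lee_fin.
have [mN|/ltnW Nm] := leqP m N.
  (* The steps from m to N stay below t, as they start above low. *)
  apply: (le_threshold_value hlambda rho0 mN) => k /andP[mk].
  rewrite leq_max => /orP[klow|].
    by have := leq_trans klow (leq_trans lowm mk); rewrite ltnn.
  exact: t_ge0.
apply: (ge_threshold_value hlambda rho0 Nm) => k /andP[Nk km].
have tk : (t <= k)%N by apply: leq_trans Nk; exact: leq_maxr.
have ok := mopen _ km.
apply/ltW/(le_lt_trans (a_homo _ _ tk ok))/t_stop.
exact: open_le tk ok.
Qed.
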